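(* The trivializable distribution $\mathcal{H}_T$ on $\mathbb{S}^7$ is of elliptic type on the open dense subset $\{(x,y)\in\mathbb{S}^7:\|x\|\neq\|y\|\}$. Otherwise (i.e. at points with $\|x\|=\|y\|$), it is of type $(0,0)$.
   Context: Let $\mathbb{S}^7\subset\mathbb{R}^4\times\mathbb{R}^4\cong\mathbb{H}^2$ be the unit sphere with points $z=(x,y)$. $\mathcal{H}_T=\mathrm{Span}\{X_1,\dots,X_4\}\subset T\mathbb{S}^7$, where $X_l(z)=A_lz$ and $$A_1(x,y)=(y{\bf k},x{\bf k}),\quad A_2(x,y)=(y{\bf j},x{\bf j}),\quad A_3(x,y)=(-y{\bf i},-x{\bf i}),\quad A_4(x,y)=(y,-x);$$ it is a rank $4$ bracket generating distribution of step two. For a corank $3$, step two bracket generating distribution $\mathcal{H}$ on a $7$-dimensional manifold $M$, the curvature is the linear bundle map $F:\Lambda^2\mathcal{H}\to TM/\mathcal{H}$, $F(X,Y)=-[X,Y]\bmod\mathcal{H}$. Let $\mathcal{H}^\perp\subset T^*M$ be the bundle of covectors annihilating $\mathcal{H}$ and $\omega=F^*:\mathcal{H}^\perp\to\Lambda^2\mathcal{H}^*$ the dual curvature map. The map $\omega^2:\mathcal{H}^\perp\to\Lambda^4\mathcal{H}^*$, $\lambda\mapsto\omega(\lambda)\wedge\omega(\lambda)$, is at each point a quadratic form on a $3$-dimensional space with values in a $1$-dimensional space, so its signature is defined up to interchanging positive and negative parts. $\mathcal{H}$ is of type $(r,s)$ at a point if the signature there is $(r,s)$ or $(s,r)$,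 and it is elliptic if the signature is $(3,0)$ or $(0,3)$. Type $(0,0)$ means that the form vanishes. *)

(* Defs.v *)
From HB Require Import structures.
From mathcomp Require Import all_boot all_order all_algebra all_fingroup.
From mathcomp Require Import all_classical all_reals all_analysis.
From mathcomp Require Import ring.

Set Implicit Arguments.
Unset Strict Implicit.
Unset Printing Implicit Defensive.

Import Order.TTheory GRing.Theory Num.Theory numFieldNormedType.Exports.

Local Open Scope classical_set_scope.
Local Open Scope ring_scope.

Notation R4 R := 'rV[R]_4.
Notation R8 R := ('rV[R]_4 * 'rV[R]_4)%type.

Section Euclidean.
Variable R : realType.

Definition dot4 (x y : R4 R) : R := \sum_(i < 4) x 0 i * y 0 i.

(* The library norm on matrices and pairs is the max norm. *)
Definition enorm (x : R4 R) : R := Num.sqrt (dot4 x x).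

Definition dot8 (z v : R8 R) : R := dot4 z.1 v.1 + dot4 z.2 v.2.

Definition S7 : set (R8 R) := [set z | dot8 z z = 1].

Lemma dot4E (x y : R4 R) :
  dot4 x y = x 0 (inord 0) * y 0 (inord 0) + x 0 (inord 1) * y 0 (inord 1) +
             x 0 (inord 2) * y 0 (inord 2) + x 0 (inord 3) * y 0 (inord 3).
Proof.
rewrite /dot4 !big_ord_recr big_ord0 /= add0r.
have e (i : 'I_4) k : nat_of_ord i = k -> i = inord k.
  by move=> <-; rewrite inord_val.
by do ![congr (_ + _)]; congr (_ * _);
  congr (fun_of_matrix _ _ _); apply: e.
Qed.

Lemma dot4_is_linear (x : R4 R) : linear (dot4 x : R4 R -> R^o).
Proof.
move=> a u v; rewrite /dot4 scaler_sumr -big_split /=.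
by apply: eq_bigr => i _; rewrite !mxE mulrDr mulrCA.
Qed.

Lemma dot8_is_linear (z : R8 R) : linear (dot8 z : R8 R -> R^o).
Proof.
move=> a u v; rewrite /dot8 /= (dot4_is_linear z.1 a) (dot4_is_linear z.2 a).
by rewrite scalerDr addrACA.
Qed.

HB.instance Definition _ (z : R8 R) :=
  GRing.isLinear.Build R (R8 R) R^o *:%R (dot8 z : R8 R -> R^o)
    (dot8_is_linear z).

Definition tangent (z : R8 R) : {vspace R8 R} :=
  lker (linfun (dot8 z : R8 R -> R^o)).

Lemma mem_tangent (z v : R8 R) : (v \in tangent z) = (dot8 z v == 0).
Proof. by rewrite memv_ker lfunE. Qed.

End Euclidean.

Section Quaternions.
Variable R : realType.

(* The row (a, b, c, d) stands for a + b i + c j + d k. *)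
Definition quat (a b c d : R) : R4 R := \row_(i < 4) [:: a; b; c; d]`_i.

Definition qmul (p q : R4 R) : R4 R :=
  let a1 := p 0 (inord 0) in let b1 := p 0 (inord 1) in
  let c1 := p 0 (inord 2) in let d1 := p 0 (inord 3) in
  let a2 := q 0 (inord 0) in let b2 := q 0 (inord 1) in
  let c2 := q 0 (inord 2) in let d2 := q 0 (inord 3) in
  quat (a1 * a2 - b1 * b2 - c1 * c2 - d1 * d2)
       (a1 * b2 + b1 * a2 + c1 * d2 - d1 * c2)
       (a1 * c2 - b1 * d2 + c1 * a2 + d1 * b2)
       (a1 * d2 + b1 * c2 - c1 * b2 + d1 * a2).

Definition qi : R4 R := quat 0 1 0 0.
Definition qj : R4 R := quat 0 0 1 0.
Definition qk : R4 R := quat 0 0 0 1.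

Definition A1 (z : R8 R) : R8 R := (qmul z.2 qk, qmul z.1 qk).
Definition A2 (z : R8 R) : R8 R := (qmul z.2 qj, qmul z.1 qj).
Definition A3 (z : R8 R) : R8 R := (- qmul z.2 qi, - qmul z.1 qi).
Definition A4 (z : R8 R) : R8 R := (z.2, - z.1).

Definition HT (z : R8 R) : {vspace R8 R} :=
  <<[:: A1 z; A2 z; A3 z; A4 z]>>%VS.

Lemma HT_tangent (z : R8 R) : (HT z <= tangent z)%VS.
Proof.
apply/span_subvP => v; rewrite !inE mem_tangent.
case/or4P=> /eqP -> {v}; apply/eqP;
  rewrite /dot8 !dot4E /= !mxE ?inordK //= ?mxE ?inordK //=; ring.
Qed.

End Quaternions.

Section ExteriorForms.
Variables (R : realType) (U : lmodType R).

Definition multilinear_form (k : nat) (f : ('I_k -> U) -> R) : Prop :=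
  forall (i : 'I_k) (v : 'I_k -> U) (a : R) (x y : U),
    f [eta v with i |-> a *: x + y] =
    a * f [eta v with i |-> x] + f [eta v with i |-> y].

Definition exterior_form (k : nat) (f : ('I_k -> U) -> R) : Prop :=
  multilinear_form f /\
  forall (v : 'I_k -> U) (i j : 'I_k), i != j -> v i = v j -> f v = 0.

Definition wedge (k l : nat) (f : ('I_k -> U) -> R) (g : ('I_l -> U) -> R)
    (v : 'I_(k + l) -> U) : R :=
  (k`! * l`!)%:R^-1 *
  \sum_(s : 'S_(k + l)) (-1) ^+ s *
    (f (fun i => v (s (lshift l i))) * g (fun j => v (s (rshift k j)))).

End ExteriorForms.

(* Sylvester: in some basis of W the form Q is a sum of r squares minus a sum
   of s squares. *)
Definition has_signature (R : realType) (L : vectType R) (W : {vspace L})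
    (Q : L -> R) (r s : nat) : Prop :=
  (r + s <= \dim W)%N /\
  exists2 b : (\dim W).-tuple L, basis_of W b &
    forall c : 'I_(\dim W) -> R,
      Q (\sum_i c i *: b`_i) =
      \sum_(i < \dim W | (i < r)%N) c i ^+ 2 - \sum_(i < \dim W | (r <= i < r + s)%N) c i ^+ 2.

Section Annihilator.
Variables (R : realType) (V : vectType R).

Definition covector (T : {vspace V}) : vectType R := 'Hom(subvs_of T, R^o).

(* vsproj T is the identity on T; it only retypes vectors of U as vectors of
   T when U <= T. *)
Definition restrict (T U : {vspace V}) (l : covector T) : covector U :=
  (l \o linfun (vsproj T \o vsval : subvs_of U -> subvs_of T))%VF.

Lemma restrict_is_linear (T U : {vspace V}) : linear (@restrict T U).
Proof. by move=> a l m; rewrite /restrict comp_lfunDl comp_lfunZl. Qed.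

HB.instance Definition _ (T U : {vspace V}) :=
  GRing.isLinear.Build R (covector T) (covector U) *:%R (@restrict T U)
    (@restrict_is_linear T U).

Definition annihilator (T U : {vspace V}) : {vspace covector T} :=
  lker (linfun (@restrict T U)).

Lemma mem_annihilator (T U : {vspace V}) (l : covector T) :
  (l \in annihilator T U) <-> (forall v, v \in U -> l (vsproj T v) = 0).
Proof.
rewrite memv_ker lfunE /=; split => [/eqP l0 v vU|l0].
  have := congr1 (fun g : covector U => g (vsproj U v)) l0.
  by rewrite /restrict comp_lfunE lfunE /= vsprojK // => ->; rewrite lfunE.
apply/eqP/lfunP => u; rewrite /restrict comp_lfunE !lfunE /=.
by apply: l0; exact: subvsP.
Qed.

End Annihilator.

Section Types.
Variable R : realType.

(* A vector field on the sphere is represented by a field on R^8 that is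
   differentiable along the sphere; for fields tangent to the sphere the
   bracket at points of the sphere depends only on their restrictions. *)
Definition bracket (X Y : R8 R -> R8 R) (z : R8 R) : R8 R :=
  'D_(X z) Y z - 'D_(Y z) X z.

Variable D : R8 R -> {vspace R8 R}.

Definition is_section (X : R8 R -> R8 R) : Prop :=
  forall p, S7 p -> differentiable X p /\ X p \in D p.

Definition two_vectors (U : Type) (u v : U) : 'I_2 -> U :=
  fun i => if i == ord0 then u else v.

(* w = omega(l), i.e. w (X, Y) = l (F (X, Y)) = - l ([X, Y]), for l in the
   annihilator of D; both uses of vsproj only retype their argument. *)
Definition is_dual_curvature (z : R8 R) (l : covector (tangent z))
    (w : ('I_2 -> subvs_of (D z)) -> R) : Prop :=
  exterior_form w /\
  forall X Y, is_section X -> is_section Y ->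
    w (two_vectors (vsproj (D z) (X z)) (vsproj (D z) (Y z))) =
    - l (vsproj (tangent z) (bracket X Y z)).

(* For D of rank 4, vol spans the line of exterior 4-forms on D z; the choice
   of vol accounts for the interchange of r and s. *)
Definition of_type (r s : nat) (z : R8 R) : Prop :=
  exists (omega : covector (tangent z) -> ('I_2 -> subvs_of (D z)) -> R)
         (vol : ('I_(2 + 2) -> subvs_of (D z)) -> R)
         (Q : covector (tangent z) -> R),
    [/\ forall l, l \in annihilator (tangent z) (D z) ->
          is_dual_curvature l (omega l),
        exterior_form vol /\ (exists v, vol v != 0),
        forall l, l \in annihilator (tangent z) (D z) ->
          forall v, wedge (omega l) (omega l) v = Q l * vol v &
        has_signature (annihilator (tangent z) (D z)) Q r s \/
        has_signature (annihilator (tangent z) (D z)) Q s r].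

Definition elliptic (z : R8 R) : Prop := of_type 3 0 z.

End Types.

(* Main.v *)
From HB Require Import structures.
Require Import Defs.
From mathcomp Require Import all_boot all_order all_algebra all_fingroup.
From mathcomp Require Import all_classical all_reals all_analysis.
From mathcomp Require Import ring lra.

(* The fields A_a are orthonormal on the sphere and skew as matrices, so
   omega(l)(A_a z, A_b z) = 2 l(A_a A_b z) for a <> b, and omega(l) ^ omega(l)
   is, up to a constant multiple of the volume form, the Pfaffian
     sum over e = i, j, k of l(xe, 0)^2 - l(0, ye)^2.
   If x <> 0, the annihilator of HT z consists of the covectors
   (|x|^2 x N, - x N x^* y) with N an imaginary quaternion.  On these
   l(xe, 0) = |x|^4 <N, e> and l(0, ye) = - <m^* N m, e> with m = x^* y, so the
   Pfaffian equals |x|^4 (|x|^4 - |y|^4) |N|^2.  If x = 0, exchange x and y,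
   which changes the sign of the Pfaffian. *)

Set Implicit Arguments.
Unset Strict Implicit.
Unset Printing Implicit Defensive.

Import Order.TTheory GRing.Theory Num.Theory numFieldNormedType.Exports.

Local Open Scope classical_set_scope.
Local Open Scope ring_scope.

(** * Quaternion coordinates and the frame *)

Section Frame.
Variable R : realType.
Implicit Types (u v w z P : R8 R) (x y p q : R4 R).

(** The curvature has to be checked against all sections, and these are maps on R^8 that are
    horizontal at points of the sphere only. An identity satisfied by sections can therefore be
    differentiated only in directions tangent to the sphere. Modulo the distribution, the bracket
    then depends on the values at z alone, through a closed formula; taking that formula as the
    definition of omega avoids extending vectors to sections. A covector is handled as the inner
    product with a vector P orthogonal to z. In the basis used for the annihilator, the three
    squares carry one common coefficient K, so the form is definite or zero, and the sign of K is
    absorbed by the volume form. *)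

Lemma dot4C x y : dot4 x y = dot4 y x.
Proof. by apply: eq_bigr => i _; rewrite mulrC. Qed.

Lemma dot8C u v : dot8 u v = dot8 v u.
Proof. by rewrite /dot8 !(dot4C u.1, dot4C u.2). Qed.

Lemma dot8Dr u v w : dot8 u (v + w) = dot8 u v + dot8 u w.
Proof. exact: raddfD. Qed.
Lemma dot8Nr u v : dot8 u (- v) = - dot8 u v.
Proof. exact: raddfN. Qed.
Lemma dot8Br u v w : dot8 u (v - w) = dot8 u v - dot8 u w.
Proof. exact: raddfB. Qed.
Lemma dot8Zr u k v : dot8 u (k *: v) = k * dot8 u v.
Proof. exact: linearZ. Qed.
Lemma dot8_sumr u n (F : 'I_n -> R8 R) :
  dot8 u (\sum_i F i) = \sum_i dot8 u (F i).
Proof. exact: raddf_sum. Qed.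
Lemma dot8Dl u v w : dot8 (u + v) w = dot8 u w + dot8 v w.
Proof. by rewrite !(dot8C _ w) dot8Dr. Qed.
Lemma dot8Zl k u v : dot8 (k *: u) v = k * dot8 u v.
Proof. by rewrite !(dot8C _ v) dot8Zr. Qed.
Lemma dot8Nl u v : dot8 (- u) v = - dot8 u v.
Proof. by rewrite !(dot8C _ v) dot8Nr. Qed.
Lemma dot8_suml u n (F : 'I_n -> R8 R) :
  dot8 (\sum_i F i) u = \sum_i dot8 (F i) u.
Proof. by rewrite dot8C dot8_sumr; under eq_bigr do rewrite dot8C. Qed.

Lemma row4P x y :
  x 0 (inord 0) = y 0 (inord 0) -> x 0 (inord 1) = y 0 (inord 1) ->
  x 0 (inord 2) = y 0 (inord 2) -> x 0 (inord 3) = y 0 (inord 3) -> x = y.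
Proof.
move=> h0 h1 h2 h3; apply/rowP => i; rewrite -[i]inord_val.
by case: i => [[|[|[|[|//]]]]] /=.
Qed.

Definition frame (a : 'I_4) z : R8 R := [:: A1 z; A2 z; A3 z; A4 z]`_a.

Lemma ord4P (T : 'I_4 -> Prop) :
  T (inord 0) -> T (inord 1) -> T (inord 2) -> T (inord 3) -> forall a, T a.
Proof.
move=> h0 h1 h2 h3 a; rewrite -[a]inord_val.
by case: a => [[|[|[|[|//]]]]] /=.
Qed.

Lemma sum4E (V : nmodType) (F : 'I_4 -> V) :
  \sum_a F a = F (inord 0) + F (inord 1) + F (inord 2) + F (inord 3).
Proof.
rewrite !big_ord_recr big_ord0 /= add0r.
by do ![congr (_ + _)]; congr F; apply: val_inj; rewrite /= inordK.
Qed.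

Lemma quatE (a b c d : R) :
  ((quat a b c d 0 (inord 0) = a) * (quat a b c d 0 (inord 1) = b) *
   (quat a b c d 0 (inord 2) = c) * (quat a b c d 0 (inord 3) = d))%type.
Proof. by rewrite !mxE !inordK. Qed.

Lemma quat_eta x :
  x = quat (x 0 (inord 0)) (x 0 (inord 1)) (x 0 (inord 2)) (x 0 (inord 3)).
Proof. by apply: row4P; rewrite quatE. Qed.

Lemma dot4_quat (a b c d a' b' c' d' : R) :
  dot4 (quat a b c d) (quat a' b' c' d') = a * a' + b * b' + c * c' + d * d'.
Proof. by rewrite dot4E !quatE. Qed.

Lemma quatD (a b c d a' b' c' d' : R) :
  quat a b c d + quat a' b' c' d' = quat (a + a') (b + b') (c + c') (d + d').
Proof. by apply: row4P; rewrite mxE !quatE. Qed.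

Lemma quatN (a b c d : R) : - quat a b c d = quat (- a) (- b) (- c) (- d).
Proof. by apply: row4P; rewrite mxE !quatE. Qed.

Lemma quatZ (k a b c d : R) :
  k *: quat a b c d = quat (k * a) (k * b) (k * c) (k * d).
Proof. by apply: row4P; rewrite mxE !quatE. Qed.

Lemma qmul_units (a b c d : R) :
  (qmul (quat a b c d) (qi R) = quat (- b) a d (- c)) *
  (qmul (quat a b c d) (qj R) = quat (- c) (- d) a b) *
  (qmul (quat a b c d) (qk R) = quat (- d) c (- b) a).
Proof.
by rewrite /qmul /qi /qj /qk !quatE;
  rewrite !(mulr0, mulr1, subr0, add0r, addr0, sub0r).
Qed.

Lemma frame_quat (a b c d a' b' c' d' : R) :
  let z := (quat a b c d, quat a' b' c' d') in
  (frame (inord 0) z = (quat (- d') c' (- b') a', quat (- d) c (- b) a)) *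
  (frame (inord 1) z = (quat (- c') (- d') a' b', quat (- c) (- d) a b)) *
  (frame (inord 2) z = (quat b' (- a') (- d') c', quat b (- a) (- d) c)) *
  (frame (inord 3) z = (quat a' b' c' d', quat (- a) (- b) (- c) (- d))).
Proof.
by rewrite /frame !inordK //= /A1 /A2 /A3 /A4 /= !qmul_units !quatN !opprK.
Qed.

(** Replaces points by explicit coordinates, after which the quaternion identities are polynomial
    identities. *)
Lemma R8_quatP (T : R8 R -> Prop) :
  (forall a b c d a' b' c' d' : R, T (quat a b c d, quat a' b' c' d')) ->
  forall z, T z.
Proof. by move=> h [x y]; rewrite [x]quat_eta [y]quat_eta. Qed.

Lemma frame_is_linear a : linear (frame a).
Proof.
move=> k; apply: R8_quatP => a1 b1 c1 d1 a2 b2 c2 d2.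
apply: R8_quatP => a3 b3 c3 d3 a4 b4 c4 d4.
pose scaleE := fun p q => erefl : k *: ((p, q) : R8 R) = (k *: p, k *: q).
pose addE := fun p q p' q' =>
  erefl : ((p, q) : R8 R) + (p', q') = (p + p', q + q').
move: a; apply: ord4P; rewrite !(scaleE, addE, quatZ, quatD) !frame_quat;
  rewrite !(scaleE, addE, quatZ, quatD); congr (quat _ _ _ _, quat _ _ _ _); ring.
Qed.

HB.instance Definition _ a :=
  GRing.isLinear.Build R (R8 R) (R8 R) *:%R (frame a) (frame_is_linear a).

Lemma frameZD (a : 'I_4) k u v :
  frame a (k *: u + v) = k *: frame a u + frame a v.
Proof. exact: frame_is_linear. Qed.

Lemma frameZ (a : 'I_4) k u : frame a (k *: u) = k *: frame a u.
Proof. exact: linearZ. Qed.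

Lemma frame_sum (a : 'I_4) n (F : 'I_n -> R8 R) :
  frame a (\sum_i F i) = \sum_i frame a (F i).
Proof. exact: raddf_sum. Qed.

Lemma frame_skew a u v : dot8 u (frame a v) = - dot8 (frame a u) v.
Proof.
move: u v a; apply: R8_quatP => a1 b1 c1 d1 a2 b2 c2 d2.
apply: R8_quatP => a3 b3 c3 d3 a4 b4 c4 d4.
by apply: ord4P; rewrite !frame_quat /dot8 !dot4_quat; ring.
Qed.

Lemma frame_dot a b z : dot8 (frame a z) (frame b z) = (a == b)%:R * dot8 z z.
Proof.
move: z a b; apply: R8_quatP => a1 b1 c1 d1 a2 b2 c2 d2.
do 2!apply: ord4P; rewrite !frame_quat /dot8 !dot4_quat -val_eqE /= !inordK //;
  rewrite ?eqxx /= ?mul1r ?mul0r; ring.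
Qed.

End Frame.

(** * Squares of 2-forms in dimension 4 *)

(** Permutations are sorted by the image i of 0. The map (i, t) |-> [lift_perm ord0 i t] is
    injective between sets of equal cardinality, and it multiplies the sign of t by (-1)^i. *)
Lemma sum_perm_lift (R : pzRingType) n (F : 'S_n.+1 -> R) :
  \sum_(s : 'S_n.+1) (-1) ^+ s * F s =
  \sum_(i < n.+1) (-1) ^+ i * \sum_(t : 'S_n) (-1) ^+ t * F (lift_perm ord0 i t).
Proof.
under [RHS]eq_bigr do rewrite big_distrr /=.
rewrite pair_bigA /=.
rewrite (reindex (fun p : 'I_n.+1 * 'S_n => lift_perm ord0 p.1 p.2)) /=.
  apply: eq_bigr => -[i t] _ /=.
  by rewrite odd_lift_perm !signr_addb !signr_odd expr0 mul1r !mulrA.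
apply: onW_bij; apply: inj_card_bij => [[i s] [j t] /= e|]; last first.
  by rewrite card_prod card_ord !card_Sn factS.
have ij : i = j by rewrite -(lift_perm_id ord0 i s) e lift_perm_id.
congr (_, _) => //; apply/permP => k; apply: (@lift_inj _ i).
by rewrite -(lift_perm_lift ord0 i s) e lift_perm_lift ij.
Qed.

Lemma sum_S1 (V : nmodType) (F : 'S_1 -> V) : \sum_(s : 'S_1) F s = F 1%g.
Proof.
rewrite (big_pred1 1%g) // => s; apply/esym/eqP/permP => i.
by rewrite [LHS]ord1 [RHS]ord1.
Qed.

(** The 24 signed terms, by iterated expansion. [G] takes naturals so that the nested lifts compute
    to numerals. *)
Lemma sum_S4 (R : comPzRingType) (G : nat -> nat -> nat -> nat -> R) :
  \sum_(s : 'S_4) (-1) ^+ s *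
     G (s (inord 0)) (s (inord 1)) (s (inord 2)) (s (inord 3)) =
    (G 0 1 2 3)%N - (G 0 1 3 2)%N - (G 0 2 1 3)%N
  + (G 0 2 3 1)%N + (G 0 3 1 2)%N - (G 0 3 2 1)%N
  - (G 1 0 2 3)%N + (G 1 0 3 2)%N + (G 1 2 0 3)%N
  - (G 1 2 3 0)%N - (G 1 3 0 2)%N + (G 1 3 2 0)%N
  + (G 2 0 1 3)%N - (G 2 0 3 1)%N - (G 2 1 0 3)%N
  + (G 2 1 3 0)%N + (G 2 3 0 1)%N - (G 2 3 1 0)%N
  - (G 3 0 1 2)%N + (G 3 0 2 1)%N + (G 3 1 0 2)%N
  - (G 3 1 2 0)%N - (G 3 2 0 1)%N + (G 3 2 1 0)%N.
Proof.
have -> : inord 0 = ord0 :> 'I_4 by apply: val_inj; rewrite /= inordK.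
have -> : inord 1 = lift ord0 ord0 :> 'I_4 by apply: val_inj; rewrite /= inordK.
have -> : inord 2 = lift ord0 (lift ord0 ord0) :> 'I_4.
  by apply: val_inj; rewrite /= inordK.
have -> : inord 3 = lift ord0 (lift ord0 (lift ord0 ord0)) :> 'I_4.
  by apply: val_inj; rewrite /= inordK.
rewrite (sum_perm_lift (fun s : 'S_4 =>
  G (s ord0) (s (lift ord0 ord0)) (s (lift ord0 (lift ord0 ord0)))
    (s (lift ord0 (lift ord0 (lift ord0 ord0)))))).
under eq_bigr => i _.
  rewrite (sum_perm_lift (fun t => G (lift_perm ord0 i t ord0) _ _ _)).
  under eq_bigr => j _.
    rewrite (sum_perm_lift (fun t =>
      G (lift_perm ord0 i (lift_perm ord0 j t) ord0) _ _ _)).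
    under eq_bigr => k _ do
      rewrite sum_S1 odd_perm1 mul1r !(lift_perm_lift, lift_perm_id) perm1.
    over.
  over.
rewrite /= !big_ord_recl !big_ord0 /= /bump /=.
rewrite !(add0n, addn0, add1n); ring.
Qed.

Lemma det4E (R : comPzRingType) (A : 'M[R]_4)
    (c := fun i j => A (inord i) (inord j)) :
  \det A =
    (c 0 0)%N * ((c 1 1)%N * ((c 2 2)%N * (c 3 3)%N - (c 2 3)%N * (c 3 2)%N)
           - (c 1 2)%N * ((c 2 1)%N * (c 3 3)%N - (c 2 3)%N * (c 3 1)%N)
           + (c 1 3)%N * ((c 2 1)%N * (c 3 2)%N - (c 2 2)%N * (c 3 1)%N))
  - (c 0 1)%N * ((c 1 0)%N * ((c 2 2)%N * (c 3 3)%N - (c 2 3)%N * (c 3 2)%N)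
           - (c 1 2)%N * ((c 2 0)%N * (c 3 3)%N - (c 2 3)%N * (c 3 0)%N)
           + (c 1 3)%N * ((c 2 0)%N * (c 3 2)%N - (c 2 2)%N * (c 3 0)%N))
  + (c 0 2)%N * ((c 1 0)%N * ((c 2 1)%N * (c 3 3)%N - (c 2 3)%N * (c 3 1)%N)
           - (c 1 1)%N * ((c 2 0)%N * (c 3 3)%N - (c 2 3)%N * (c 3 0)%N)
           + (c 1 3)%N * ((c 2 0)%N * (c 3 1)%N - (c 2 1)%N * (c 3 0)%N))
  - (c 0 3)%N * ((c 1 0)%N * ((c 2 1)%N * (c 3 2)%N - (c 2 2)%N * (c 3 1)%N)
           - (c 1 1)%N * ((c 2 0)%N * (c 3 2)%N - (c 2 2)%N * (c 3 0)%N)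
           + (c 1 2)%N * ((c 2 0)%N * (c 3 1)%N - (c 2 1)%N * (c 3 0)%N)).
Proof.
transitivity (\sum_(s : 'S_4) (-1) ^+ s *
    (fun i j k l => c 0%N i * c 1%N j * c 2%N k * c 3%N l)
      (s (inord 0)) (s (inord 1)) (s (inord 2)) (s (inord 3))).
  apply: eq_bigr => s _; rewrite /c !inord_val; congr (_ * _).
  rewrite !big_ord_recr big_ord0 /= mul1r.
  by do ![congr (_ * _)]; congr (fun_of_matrix A _ (s _));
    apply: val_inj; rewrite /= inordK.
rewrite (sum_S4 (fun i j k l => c 0%N i * c 1%N j * c 2%N k * c 3%N l)); ring.
Qed.

(** Each of the three ways to split four vectors into two pairs comes from 8 permutations, which
    contribute equally by antisymmetry; the normalization 1/(2! 2!) turns 8 into 2. *)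
Lemma wedge_square (R : realType) (U : lmodType R) (F : U -> U -> R)
    (v : 'I_(2 + 2) -> U) (c := fun i j => F (v (inord i)) (v (inord j))) :
  (forall u w, F w u = - F u w) ->
  wedge (fun w => F (w ord0) (w ord_max)) (fun w => F (w ord0) (w ord_max)) v =
  2 * ((c 0 1)%N * (c 2 3)%N - (c 0 2)%N * (c 1 3)%N + (c 0 3)%N * (c 1 2)%N).
Proof.
move=> antiF; rewrite /wedge.
have -> : \sum_(s : 'S_(2 + 2)) (-1) ^+ s *
    (F (v (s (lshift 2 ord0))) (v (s (lshift 2 ord_max))) *
     F (v (s (rshift 2 ord0))) (v (s (rshift 2 ord_max)))) =
  \sum_(s : 'S_4) (-1) ^+ s * (fun i j k l => c i j * c k l)
      (s (inord 0)) (s (inord 1)) (s (inord 2)) (s (inord 3)).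
  apply: eq_bigr => s _; rewrite /c !inord_val.
  by do ![congr (_ * _)]; congr (F (v (s _)) (v (s _)));
    apply: val_inj; rewrite /= inordK.
rewrite (sum_S4 (fun i j k l => c i j * c k l)).
have antic i j : c j i = - c i j by rewrite /c antiF.
rewrite (antic 0 1)%N (antic 0 2)%N (antic 0 3)%N (antic 1 2)%N.
rewrite (antic 1 3)%N (antic 2 3)%N.
have -> : (2`! * 2`!)%:R = 4 :> R by [].
by field.
Qed.

(** The rule Pf(A W A^T) = Pf(W) det A for a skew matrix W with entries [w01], ..., [w23]; [F i j]
    is the (i, j) entry of A W A^T. *)
Lemma pfaffian_mul_det (R : comPzRingType) (A : 'M[R]_4)
    (w01 w02 w03 w12 w13 w23 : R)
    (c := fun i j => A (inord i) (inord j))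
    (m := fun i j k l => c i k * c j l - c i l * c j k)
    (F := fun i j =>
      (m i j 0 1)%N * w01 + (m i j 0 2)%N * w02 + (m i j 0 3)%N * w03 +
      (m i j 1 2)%N * w12 + (m i j 1 3)%N * w13 + (m i j 2 3)%N * w23) :
  (F 0 1)%N * (F 2 3)%N - (F 0 2)%N * (F 1 3)%N + (F 0 3)%N * (F 1 2)%N =
  (w01 * w23 - w02 * w13 + w03 * w12) * \det A.
Proof.
rewrite det4E /F /m /c.
move: (A (inord 0) (inord 0)) (A (inord 0) (inord 1))
    (A (inord 0) (inord 2)) (A (inord 0) (inord 3))
  (A (inord 1) (inord 0)) (A (inord 1) (inord 1))
    (A (inord 1) (inord 2)) (A (inord 1) (inord 3))
  (A (inord 2) (inord 0)) (A (inord 2) (inord 1))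
    (A (inord 2) (inord 2)) (A (inord 2) (inord 3))
  (A (inord 3) (inord 0)) (A (inord 3) (inord 1))
    (A (inord 3) (inord 2)) (A (inord 3) (inord 3)) => *.
ring.
Qed.

Lemma det_exterior_form (R : realType) (U : lmodType R) n (f : 'I_n -> U -> R) :
  (forall j k (u w : U), f j (k *: u + w) = k * f j u + f j w) ->
  exterior_form (fun v : 'I_n -> U => \det (\matrix_(i, j) f j (v i))).
Proof.
move=> lin_f; split=> [i v k u w|v i j ij eq_v]; last first.
  by apply: (determinant_alternate ij) => l; rewrite !mxE eq_v.
rewrite -[X in _ = _ + X]mul1r; apply: (@determinant_multilinear _ _ _ _ _ i).
- by apply/rowP => l; rewrite !mxE /= eqxx lin_f mul1r.
- apply/matrixP => l m; rewrite !mxE /=.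
  by rewrite eq_sym (negbTE (neq_lift i l)).
- apply/matrixP => l m; rewrite !mxE /=.
  by rewrite eq_sym (negbTE (neq_lift i l)).
Qed.

(** * The curvature form *)

Section Curvature.
Variable R : realType.
Implicit Types (u v w z P : R8 R) (x y : R4 R).

Lemma frame_in_HT a z : frame a z \in HT z.
Proof.
move: a; apply: ord4P; apply: memv_span;
  by rewrite /frame inordK // !inE eqxx ?orbT.
Qed.

Lemma HT_coord z u : S7 z -> u \in HT z ->
  u = \sum_a dot8 (frame a z) u *: frame a z.
Proof.
move=> z1 uH; have [k kE] : exists k, u = \sum_a k a *: frame a z.
  by eexists; exact: (@coord_span _ _ _ [tuple A1 z; A2 z; A3 z; A4 z] u uH).
rewrite [LHS]kE; apply: eq_bigr => a _; congr (_ *: _).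
rewrite kE dot8_sumr (bigD1 a) //= big1 => [|b ba].
  by rewrite dot8Zr frame_dot eqxx z1 !mulr1 addr0.
by rewrite dot8Zr frame_dot eq_sym (negbTE ba) mul0r mulr0.
Qed.

(** The Clifford relation: A_a z and A_b z are orthogonal for all z, so A_a A_b is skew, and its
    transpose is A_b A_a. *)
Lemma frame_anti a b z : a != b -> frame a (frame b z) = - frame b (frame a z).
Proof.
move: z a b; apply: R8_quatP => a1 b1 c1 d1 a2 b2 c2 d2.
pose oppE := fun p q => erefl : - ((p, q) : R8 R) = (- p, - q).
by do 2!apply: ord4P; rewrite ?eqxx // => _; rewrite !frame_quat oppE !quatN;
  congr (quat _ _ _ _, quat _ _ _ _); ring.
Qed.

(* Modulo HT z this is the bracket of two sections with values u and v at z: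
   only the derivatives of the linear fields [frame a] contribute. *)
Definition twist z u v : R8 R :=
  \sum_a (dot8 (frame a z) v *: frame a u - dot8 (frame a z) u *: frame a v).

Lemma twist_tangent z u v : twist z u v \in tangent z.
Proof.
rewrite mem_tangent dot8_sumr big1 // => a _.
by rewrite dot8Br !dot8Zr !frame_skew; ring.
Qed.

Lemma twistC z u v : twist z v u = - twist z u v.
Proof. by rewrite -sumrN; apply: eq_bigr => a _; rewrite opprB. Qed.

Lemma twist_linear z u k v w :
  twist z u (k *: v + w) = k *: twist z u v + twist z u w.
Proof.
rewrite scaler_sumr -big_split /=; apply: eq_bigr => a _.
rewrite dot8Dr dot8Zr frameZD scalerBr scalerDr scalerDl !scalerA.
by rewrite opprD addrACA [_ * k]mulrC.
Qed.

Definition im (i : 'I_3) : R4 R := [:: qi R; qj R; qk R]`_i.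

Definition pfaffian z P : R :=
  \sum_i (dot4 P.1 (qmul z.1 (im i)) ^+ 2 - dot4 P.2 (qmul z.2 (im i)) ^+ 2).

Lemma imE :
  (im (inord 0) = qi R) * (im (inord 1) = qj R) * (im (inord 2) = qk R).
Proof. by rewrite /im !inordK. Qed.

Lemma sum3E (V : nmodType) (F : 'I_3 -> V) :
  \sum_a F a = F (inord 0) + F (inord 1) + F (inord 2).
Proof.
rewrite !big_ord_recr big_ord0 /= add0r.
by do ![congr (_ + _)]; congr F; apply: val_inj; rewrite /= inordK.
Qed.

Lemma ord3P (T : 'I_3 -> Prop) :
  T (inord 0) -> T (inord 1) -> T (inord 2) -> forall a, T a.
Proof.
move=> h0 h1 h2 a; rewrite -[a]inord_val.
by case: a => [[|[|[|//]]]] /=.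
Qed.

(** Complementary pairs of indices give differences of squares. For instance A_1 A_4 z = (-xk, yk)
    and A_2 A_3 z = (-xk, -yk), so [w 0 3 * w 1 2] is the k-term of [pfaffian]; the other two
    products give i and j. *)
Lemma pfaffian_frame z P
    (w := fun a b => dot8 P (frame (inord a) (frame (inord b) z))) :
  (w 0 1)%N * (w 2 3)%N - (w 0 2)%N * (w 1 3)%N + (w 0 3)%N * (w 1 2)%N =
  pfaffian z P.
Proof.
rewrite /w /pfaffian sum3E; move: z P {w}.
apply: R8_quatP => a1 b1 c1 d1 a2 b2 c2 d2.
apply: R8_quatP => a3 b3 c3 d3 a4 b4 c4 d4.
by rewrite !imE !frame_quat !qmul_units /dot8 !dot4_quat; ring.
Qed.

(** In frame coordinates the left side is the sum of m_ab w_ab over all a, b. Both factors are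
    antisymmetric off the diagonal and m_aa = 0, whence the factor 2 and the restriction to a <
    b. *)
Lemma dot8_twist z P u v
    (w := fun a b => dot8 P (frame (inord a) (frame (inord b) z)))
    (m := fun a b => dot8 (frame (inord a) z) u * dot8 (frame (inord b) z) v
                   - dot8 (frame (inord b) z) u * dot8 (frame (inord a) z) v) :
  S7 z -> u \in HT z -> v \in HT z ->
  - dot8 P (twist z u v) =
  2 * ((m 0 1)%N * (w 0 1)%N + (m 0 2)%N * (w 0 2)%N + (m 0 3)%N * (w 0 3)%N +
       (m 1 2)%N * (w 1 2)%N + (m 1 3)%N * (w 1 3)%N + (m 2 3)%N * (w 2 3)%N).
Proof.
move=> z1 uH vH; rewrite dot8_sumr.
have expand a (x : R8 R) : x \in HT z ->
    dot8 P (frame a x) =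
    \sum_b dot8 (frame b z) x * dot8 P (frame a (frame b z)).
  move=> xH; rewrite {1}(HT_coord z1 xH) frame_sum dot8_sumr.
  by apply: eq_bigr => b _; rewrite [frame a _]frameZ dot8Zr.
under eq_bigr => a _ do rewrite dot8Br !dot8Zr !expand //.
have antiw a b : (a < 4)%N -> (b < 4)%N -> a != b -> w a b = - w b a.
  move=> a4 b4 ab; rewrite /w frame_anti ?dot8Nr //.
  by apply: contra ab => /eqP/(congr1 val); rewrite /= !inordK // => ->.
rewrite !sum4E -!/(w _ _).
rewrite (antiw 1 0)%N // (antiw 2 0)%N // (antiw 3 0)%N // (antiw 2 1)%N //.
rewrite (antiw 3 1)%N // (antiw 3 2)%N // /m; ring.
Qed.

(** The constant 8 is the 2 of [wedge_square] times the square of the 2 of [dot8_twist]. *)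
Lemma wedge_twist z P (v : 'I_(2 + 2) -> subvs_of (HT z)) : S7 z ->
  let om (w : 'I_2 -> subvs_of (HT z)) :=
    - dot8 P (twist z (vsval (w ord0)) (vsval (w ord_max))) in
  wedge om om v =
  8 * pfaffian z P * \det (\matrix_(i, a) dot8 (frame a z) (vsval (v i))).
Proof.
move=> z1 /=.
rewrite (wedge_square (F := fun u w : subvs_of (HT z) =>
  - dot8 P (twist z (vsval u) (vsval w)))).
  rewrite -pfaffian_frame.
  rewrite !dot8_twist ?subvsP //.
  set A := \matrix_(i, a) _.
  have AE i a : dot8 (frame (inord a) z) (vsval (v (inord i))) =
    A (inord i) (inord a) by rewrite mxE.
  rewrite !AE -[RHS]mulrA -pfaffian_mul_det; ring.
by move=> u w; rewrite twistC dot8Nr.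
Qed.

End Curvature.

(** * Covectors annihilating the distribution *)

Section Annihilator.
Variable R : realType.
Implicit Types (u v w z P : R8 R) (x y p q : R4 R).

Definition qconj x : R4 R :=
  quat (x 0 (inord 0)) (- x 0 (inord 1)) (- x 0 (inord 2)) (- x 0 (inord 3)).

Lemma qconj_quat (a b c d : R) :
  qconj (quat a b c d) = quat a (- b) (- c) (- d).
Proof. by rewrite /qconj !quatE. Qed.

Lemma qmul_quat (a b c d a' b' c' d' : R) :
  qmul (quat a b c d) (quat a' b' c' d') =
  quat (a * a' - b * b' - c * c' - d * d') (a * b' + b * a' + c * d' - d * c')
       (a * c' - b * d' + c * a' + d * b') (a * d' + b * c' - c * b' + d * a').
Proof. by rewrite /qmul !quatE. Qed.

(** Orthogonality to z makes P the unique vector representing its covector on the tangent space. *)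
Definition conormal z P : Prop :=
  dot8 P z = 0 /\ forall a, dot8 P (frame a z) = 0.

(* p = x N and q = - x N x^* y (up to scale), N imaginary, solve the equation
   y^* p = q^* x, which says that (p, q) is orthogonal to the frame. *)
Definition conormal_basis z (i : 'I_3) : R8 R :=
  (dot4 z.1 z.1 *: qmul z.1 (im R i),
   - qmul (qmul (qmul z.1 (im R i)) (qconj z.1)) z.2).

Lemma conormal_sum z n (F : 'I_n -> R8 R) (c : 'I_n -> R) :
  (forall i, conormal z (F i)) -> conormal z (\sum_i c i *: F i).
Proof.
move=> h; split=> [|a]; rewrite dot8_suml big1 // => i _; rewrite dot8Zl.
  by rewrite (h i).1 mulr0.
by rewrite (h i).2 mulr0.
Qed.

Lemma conormal_basisP z i : conormal z (conormal_basis z i).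
Proof.
move: z i; apply: R8_quatP => a1 b1 c1 d1 a2 b2 c2 d2; rewrite /conormal_basis.
apply: ord3P; rewrite !imE /= !qmul_units !qconj_quat !qmul_quat quatN quatZ;
  rewrite dot4_quat; (split; last (apply: ord4P; rewrite !frame_quat));
  rewrite /dot8 !dot4_quat; ring.
Qed.

(** The vectors xi, xj, xk are orthogonal of length |x|. This gives both the independence of the
    basis when x is nonzero and the positive squares of the Pfaffian. *)
Lemma conormal_basis_dot z (c : 'I_3 -> R) i :
  dot4 (\sum_j c j *: conormal_basis z j).1 (qmul z.1 (im R i)) =
  dot4 z.1 z.1 ^+ 2 * c i.
Proof.
move: z i; apply: R8_quatP => a1 b1 c1 d1 a2 b2 c2 d2.
rewrite sum3E /conormal_basis /= !imE.
by apply: ord3P; rewrite !imE !qmul_units !dot4_quat !quatZ !quatD dot4_quat; ring.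
Qed.

(** This is |m^* N m|^2 = |m|^4 |N|^2 for N = c1 i + c2 j + c3 k. *)
Lemma quat_conj_norm (m0 m1 m2 m3 c1 c2 c3 : R) :
  (c1 * (m0 ^+ 2 + m1 ^+ 2 - m2 ^+ 2 - m3 ^+ 2) +
     2 * c2 * (m1 * m2 + m0 * m3) + 2 * c3 * (m1 * m3 - m0 * m2)) ^+ 2 +
  (2 * c1 * (m1 * m2 - m0 * m3) + c2 * (m0 ^+ 2 - m1 ^+ 2 + m2 ^+ 2 - m3 ^+ 2) +
     2 * c3 * (m2 * m3 + m0 * m1)) ^+ 2 +
  (2 * c1 * (m1 * m3 + m0 * m2) + 2 * c2 * (m2 * m3 - m0 * m1) +
     c3 * (m0 ^+ 2 - m1 ^+ 2 - m2 ^+ 2 + m3 ^+ 2)) ^+ 2 =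
  (m0 ^+ 2 + m1 ^+ 2 + m2 ^+ 2 + m3 ^+ 2) ^+ 2 * (c1 ^+ 2 + c2 ^+ 2 + c3 ^+ 2).
Proof. ring. Qed.

Lemma pfaffian_conormal z (c : 'I_3 -> R) :
  pfaffian z (\sum_i c i *: conormal_basis z i) =
  dot4 z.1 z.1 ^+ 2 * (dot4 z.1 z.1 ^+ 2 - dot4 z.2 z.2 ^+ 2) * \sum_i c i ^+ 2.
Proof.
rewrite /pfaffian; under eq_bigr do rewrite conormal_basis_dot.
move: z; apply: R8_quatP => a1 b1 c1 d1 a2 b2 c2 d2.
rewrite !sum3E /conormal_basis /= !imE.
rewrite !qmul_units !qconj_quat !qmul_quat !quatN !quatZ !quatD !dot4_quat.
move: (c (inord 0)) (c (inord 1)) (c (inord 2)) => k1 k2 k3.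
(* The coordinates of m = x^* y. *)
pose m0 := a1 * a2 + b1 * b2 + c1 * c2 + d1 * d2.
pose m1 := a1 * b2 - b1 * a2 - c1 * d2 + d1 * c2.
pose m2 := a1 * c2 + b1 * d2 - c1 * a2 - d1 * b2.
pose m3 := a1 * d2 - b1 * c2 + c1 * b2 - d1 * a2.
have mE : (a1 * a1 + b1 * b1 + c1 * c1 + d1 * d1) *
    (a2 * a2 + b2 * b2 + c2 * c2 + d2 * d2) =
    m0 ^+ 2 + m1 ^+ 2 + m2 ^+ 2 + m3 ^+ 2.
  by rewrite /m0 /m1 /m2 /m3; ring.
have := quat_conj_norm m0 m1 m2 m3 k1 k2 k3; rewrite -mE.
set X1 := (X in X ^+ 2 + _ + _ = _); set X2 := (X in _ + X ^+ 2 + _ = _).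
set X3 := (X in _ + _ + X ^+ 2 = _) => XE.
set Y1 := (X in _ ^+ 2 - X ^+ 2 + _ + _ = _).
set Y2 := (X in _ + (_ ^+ 2 - X ^+ 2) + _ = _).
set Y3 := (X in _ + _ + (_ ^+ 2 - X ^+ 2) = _).
have Y1E : Y1 = - X1 by rewrite /Y1 /X1 /m0 /m1 /m2 /m3; ring.
have Y2E : Y2 = - X2 by rewrite /Y2 /X2 /m0 /m1 /m2 /m3; ring.
have Y3E : Y3 = - X3 by rewrite /Y3 /X3 /m0 /m1 /m2 /m3; ring.
rewrite Y1E Y2E Y3E !sqrrN.
move: XE {Y1E Y2E Y3E}.
move: (a1 * a1 + _ + _ + _) (a2 * a2 + _ + _ + _) X1 X2 X3.
move=> n m X1 X2 X3 XE.
by apply: (@etrans _ _ (n ^+ 4 * (k1 ^+ 2 + k2 ^+ 2 + k3 ^+ 2) -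
  (n * m) ^+ 2 * (k1 ^+ 2 + k2 ^+ 2 + k3 ^+ 2))); [rewrite -XE|]; ring.
Qed.

(** Expansion in the orthogonal vectors x, xi, xj, xk, multiplied by a power of |x| to avoid
    division. Every correction term has a factor p.x, q.x - p.y or q.(xe) + p.(ye), each of which is
    zero for conormal (p, q). *)
Lemma conormal_decomposition x y p q (e := fun i => qmul x (im R i)) :
  (dot4 x x ^+ 2 *: (p, q) : R8 R) =
  \sum_i dot4 p (e i) *: conormal_basis (x, y) i +
  ((dot4 x x * dot4 p x) *: x,
   (dot4 p x * dot4 x x) *: y +
   dot4 x x *: ((dot4 q x - dot4 p y) *: x +
      \sum_i (dot4 q (e i) + dot4 p (qmul y (im R i))) *: e i)).
Proof.
rewrite /e {e} !sum3E /conormal_basis /= !imE.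
rewrite [x]quat_eta [y]quat_eta [p]quat_eta [q]quat_eta.
move: (x 0 (inord 0)) (x 0 (inord 1)) (x 0 (inord 2)) (x 0 (inord 3))
  => a1 b1 c1 d1.
move: (y 0 (inord 0)) (y 0 (inord 1)) (y 0 (inord 2)) (y 0 (inord 3))
  => a2 b2 c2 d2.
move: (p 0 (inord 0)) (p 0 (inord 1)) (p 0 (inord 2)) (p 0 (inord 3))
  => a3 b3 c3 d3.
move: (q 0 (inord 0)) (q 0 (inord 1)) (q 0 (inord 2)) (q 0 (inord 3))
  => a4 b4 c4 d4.
rewrite !qmul_units !qconj_quat !qmul_quat !quatN !dot4_quat.
pose scaleE := fun k (p q : R4 R) => 
  erefl : k *: ((p, q) : R8 R) = (k *: p, k *: q).
pose addE := fun p q p' q' : R4 R =>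
  erefl : ((p, q) : R8 R) + (p', q') = (p + p', q + q').
rewrite !(scaleE, addE) !(quatZ, quatD).
congr (quat _ _ _ _, quat _ _ _ _).
all: ring.
Qed.

Lemma conormal_dot z P (x := z.1) (y := z.2) (p := P.1) (q := P.2) :
  conormal z P ->
  [/\ dot4 p x = - dot4 q y, dot4 q x = dot4 p y &
      forall i, dot4 q (qmul x (im R i)) = - dot4 p (qmul y (im R i))].
Proof.
have dotNr (u v : R4 R) : dot4 u (- v) = - dot4 u v.
  by rewrite -sumrN; apply: eq_bigr => i _; rewrite mxE mulrN.
rewrite /x /y /p /q => -[Pz Pf]; split.
- by apply/eqP; rewrite -addr_eq0 -[_ + _]/(dot8 P z) Pz.
- move: (Pf (inord 3)); rewrite /frame inordK //= /dot8 /= dotNr.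
  by move/eqP; rewrite subr_eq0 => /eqP.
- apply: ord3P; rewrite !imE; apply/eqP; rewrite -addr_eq0 addrC.
  + move: (Pf (inord 2)); rewrite /frame inordK //= /dot8 /= !dotNr -opprD.
    by move/eqP; rewrite oppr_eq0.
  + by move: (Pf (inord 1)); rewrite /frame inordK //= /dot8 /= => ->.
  + by move: (Pf (inord 0)); rewrite /frame inordK //= /dot8 /= => ->.
Qed.

(** Obtained by expanding |x|^2 q.y along x, xe and |y|^2 p.x along y, ye. For conormal (p, q) the
    right side is zero and q.y = - p.x, so on the sphere the identity reduces to p.x = 0. *)
Lemma dot4_expand x y p q :
  dot4 x x * dot4 q y - dot4 y y * dot4 p x =
  dot4 x y * (dot4 q x - dot4 p y) +
  \sum_i dot4 (qmul x (im R i)) y *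
    (dot4 q (qmul x (im R i)) + dot4 p (qmul y (im R i))).
Proof.
rewrite sum3E !imE [x]quat_eta [y]quat_eta [p]quat_eta [q]quat_eta.
rewrite !qmul_units !dot4_quat; ring.
Qed.

Lemma conormal_span z P : S7 z -> conormal z P ->
  dot4 z.1 z.1 ^+ 2 *: P =
  \sum_i dot4 P.1 (qmul z.1 (im R i)) *: conormal_basis z i.
Proof.
case: z P => x y [p q] /= z1 /conormal_dot /= [px qx qe].
have p0 : dot4 p x = 0.
  have := dot4_expand x y p q; rewrite qx subrr mulr0 add0r big1 => [|i _].
    move: z1; rewrite /S7 /= /dot8 /= => z1.
    have -> : dot4 q y = - dot4 p x by rewrite px opprK.
    by rewrite mulrN -opprD -mulrDl z1 mul1r => /eqP; rewrite oppr_eq0 => /eqP.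
  by rewrite qe addNr mulr0.
rewrite (conormal_decomposition x y) p0 mulr0 mul0r !scale0r add0r.
rewrite qx subrr scale0r add0r [X in _ *: X]big1 => [|i _].
  by rewrite scaler0 [X in _ + X](_ : _ = 0) ?addr0.
by rewrite qe addNr scale0r.
Qed.

End Annihilator.

(** * Exchange of x and y, and covectors as vectors *)

Section Conormal.
Variable R : realType.
Implicit Types (u v w z P : R8 R) (x y p q : R4 R).

Definition swap z : R8 R := (z.2, z.1).

Lemma swap_sum n (c : 'I_n -> R) (F : 'I_n -> R8 R) :
  swap (\sum_i c i *: F i) = \sum_i c i *: swap (F i).
Proof. by apply: (big_morph swap) => [[? ?] [? ?]|]. Qed.

Lemma swapK : involutive swap.
Proof. by case. Qed.

Lemma dot8_swap u v : dot8 (swap u) (swap v) = dot8 u v.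
Proof. by rewrite /dot8 addrC. Qed.

Lemma frame_swap a z :
  frame a (swap z) = swap (frame a z) \/ frame a (swap z) = - swap (frame a z).
Proof.
move: a; apply: ord4P; rewrite /frame !inordK //=; try by left.
by right; rewrite /A4 /swap /= -[RHS]/(- - z.1, - z.2) opprK.
Qed.

Lemma conormal_swap z P : conormal z P -> conormal (swap z) (swap P).
Proof.
case=> Pz Pf; split=> [|a]; first by rewrite dot8_swap.
by case: (frame_swap a z) => ->; rewrite ?dot8Nr dot8_swap Pf ?oppr0.
Qed.

Lemma pfaffian_swap z P : pfaffian (swap z) (swap P) = - pfaffian z P.
Proof. by rewrite -sumrN; apply: eq_bigr => i _; rewrite opprB. Qed.

Lemma dot4_ge0 x : 0 <= dot4 x x.
Proof. by apply: sumr_ge0 => i _; rewrite -expr2 sqr_ge0. Qed.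

Lemma dot4_eq0 x : dot4 x x = 0 -> x = 0.
Proof.
rewrite /dot4 => /eqP; rewrite psumr_eq0 => [/allP x0|i _]; last first.
  by rewrite -expr2 sqr_ge0.
apply/rowP => i; rewrite mxE; apply/eqP.
by have := x0 i (mem_index_enum _); rewrite /= -expr2 sqrf_eq0.
Qed.

Lemma dot8_eq0 z : dot8 z z = 0 -> z = 0.
Proof.
case: z => x y /eqP; rewrite /dot8 paddr_eq0 ?dot4_ge0 //= => /andP[].
by move=> /eqP/dot4_eq0 -> /eqP/dot4_eq0 ->.
Qed.

(** Independence and spanning are stated by coefficients because [conormal] is a predicate on
    vectors; [annihilator_basis] transfers them to the space of covectors. *)
Definition diagonal_basis z (b : 'I_3 -> R8 R) (K : R) : Prop :=
  [/\ forall i, conormal z (b i),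
      forall c, \sum_i c i *: b i = 0 -> forall i, c i = 0,
      forall P, conormal z P -> exists c, P = \sum_i c i *: b i &
      forall c, pfaffian z (\sum_i c i *: b i) = K * \sum_i c i ^+ 2].

Lemma conormal_basis_diagonal z : S7 z -> dot4 z.1 z.1 != 0 ->
  diagonal_basis z (conormal_basis z)
    (dot4 z.1 z.1 ^+ 2 * (dot4 z.1 z.1 ^+ 2 - dot4 z.2 z.2 ^+ 2)).
Proof.
move=> z1 x0; split=> [i|c c0 i|P Pz|c].
- exact: conormal_basisP.
- have := conormal_basis_dot z c i; rewrite c0 /= [dot4 _ _]big1.
    by move/esym/eqP; rewrite mulf_eq0 expf_eq0 (negbTE x0) => /eqP.
  by move=> j _; rewrite mxE mul0r.
- exists (fun i => (dot4 z.1 z.1 ^+ 2)^-1 * dot4 P.1 (qmul z.1 (im R i))).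
  under eq_bigr do rewrite -scalerA.
  by rewrite -scaler_sumr -(conormal_span z1 Pz) scalerA mulVf ?expf_neq0 ?scale1r.
- exact: pfaffian_conormal.
Qed.

Lemma diagonal_basis_swap z b K :
  diagonal_basis z b K -> diagonal_basis (swap z) (swap \o b) (- K).
Proof.
case=> bz b_free b_span bK; split=> [i|c|P|c].
- exact: conormal_swap.
- rewrite -swap_sum => /(congr1 swap); rewrite swapK; exact: b_free.
- move=> /conormal_swap; rewrite swapK => /b_span[c /(congr1 swap)].
  by rewrite swapK swap_sum => ->; exists c.
- by rewrite -swap_sum pfaffian_swap bK mulNr.
Qed.

Lemma diagonal_basis_exists z : S7 z ->
  exists b K, diagonal_basis z b K /\ ((K == 0) = (dot4 z.1 z.1 == dot4 z.2 z.2)).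
Proof.
move=> z1; have [x0|x0] := eqVneq (dot4 z.1 z.1) 0.
  have y0 : dot4 z.2 z.2 != 0.
    apply/eqP => y0; move: z1; rewrite /S7 /= /dot8 x0 y0 addr0 => /esym/eqP.
    by rewrite oner_eq0.
  have sz1 : S7 (swap z) by rewrite /S7 /= dot8_swap.
  do 2 eexists; split.
    by rewrite -[z in diagonal_basis z]swapK; apply: diagonal_basis_swap;
      apply: conormal_basis_diagonal.
  rewrite oppr_eq0 mulf_eq0 expf_eq0 /= (negbTE y0) subr_eq0 x0.
  by rewrite eqf_sqr oppr0 orbb eq_sym.
exists (conormal_basis z); eexists; split; first exact: conormal_basis_diagonal.
rewrite mulf_eq0 expf_eq0 /= (negbTE x0) subr_eq0.
by rewrite eqrXn2 ?dot4_ge0.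
Qed.

Definition covec z P : covector (tangent z) :=
  linfun ((dot8 P : R8 R -> R^o) \o (vsval : subvs_of (tangent z) -> R8 R)).

Lemma covecE z P v : v \in tangent z -> covec z P (vsproj (tangent z) v) = dot8 P v.
Proof. by move=> vz; rewrite lfunE /= vsprojK. Qed.

Lemma covec_sum z n (c : 'I_n -> R) (F : 'I_n -> R8 R) :
  covec z (\sum_i c i *: F i) = \sum_i c i *: covec z (F i).
Proof.
apply/lfunP => u; rewrite sum_lfunE lfunE /= dot8_suml.
by apply: eq_bigr => i _; rewrite !lfunE /= lfunE dot8Zl.
Qed.

Lemma linear_dot8 (f : R8 R -> R) : linear (f : R8 R -> R^o) ->
  exists P, forall v, f v = dot8 P v.
Proof.
move=> lin_f; pose fM := GRing.isLinear.Build _ _ _ _ _ lin_f.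
pose g : {linear R8 R -> R^o} := HB.pack (f : R8 R -> R^o) fM.
exists (\row_i g (delta_mx 0 i, 0), \row_i g (0, delta_mx 0 i)) => -[x y].
rewrite /dot8 /dot4 /= -[LHS]/(g (x, y)).
have -> : (x, y) = \sum_i x 0 i *: ((delta_mx 0 i, 0) : R8 R) +
                   \sum_i y 0 i *: ((0, delta_mx 0 i) : R8 R).
  have e1 : \sum_i x 0 i *: ((delta_mx 0 i, 0) : R8 R) = (x, 0).
    rewrite {2}[x]row_sum_delta.
    by rewrite (big_morph (fun x => (x, 0) : R8 R) (id1 := 0) (op1 := +%R)) //;
      [apply: eq_bigr => i _; congr pair; rewrite scaler0
      |move=> a b; congr pair; rewrite addr0].
  have e2 : \sum_i y 0 i *: ((0, delta_mx 0 i) : R8 R) = (0, y).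
    rewrite {2}[y]row_sum_delta.
    by rewrite (big_morph (fun x => (0, x) : R8 R) (id1 := 0) (op1 := +%R)) //;
      [apply: eq_bigr => i _; congr pair; rewrite scaler0
      |move=> a b; congr pair; rewrite addr0].
  by rewrite e1 e2; congr pair; rewrite ?addr0 ?add0r.
rewrite linearD !linear_sum; congr (_ + _); apply: eq_bigr => i _;
  by rewrite linearZ mxE mulrC.
Qed.

(** The form l is extended to R^8 through the orthogonal projection v - (z.v) z. The extension kills
    z, so its representing vector is orthogonal to z. *)
Lemma covec_surj z (l : covector (tangent z)) : S7 z ->
  exists2 P, dot8 P z = 0 & l = covec z P.
Proof.
move=> z1; pose f v := l (vsproj (tangent z) (v - dot8 z v *: z)).
have [|P fP] := @linear_dot8 f.
  move=> k u v; rewrite /f -linearP /=; congr (l _); rewrite -linearP; congr vsproj.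
  rewrite dot8Dr dot8Zr scalerBr scalerDl scalerA opprD addrACA //.
exists P; first by rewrite -fP /f [dot8 z z]z1 scale1r subrr !linear0.
apply/lfunP => u; rewrite lfunE /= -fP /f.
have /eqP -> : dot8 z (vsval u) == 0 by rewrite -mem_tangent subvsP.
by rewrite scale0r subr0 vsvalK.
Qed.

Lemma frame_tangent a z : frame a z \in tangent z.
Proof. exact: (subvP (HT_tangent z) _ (frame_in_HT a z)). Qed.

Lemma covec_annihilator z P : S7 z -> dot8 P z = 0 ->
  covec z P \in annihilator (tangent z) (HT z) <-> conormal z P.
Proof.
move=> z1 Pz; rewrite mem_annihilator; split=> [h|[_ Pf] v vH].
  split=> // a; rewrite -(covecE P (frame_tangent a z)); apply: h; exact: frame_in_HT.
rewrite covecE ?(subvP (HT_tangent z)) // (HT_coord z1 vH) dot8_sumr big1 //.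
by move=> a _; rewrite dot8Zr Pf mulr0.
Qed.

Lemma annihilatorP z l : S7 z -> l \in annihilator (tangent z) (HT z) ->
  exists2 P, conormal z P & l = covec z P.
Proof.
move=> z1; have [P Pz ->] := covec_surj l z1.
by move=> /(covec_annihilator z1 Pz) cP; exists P.
Qed.

Lemma annihilator_basis z b K : S7 z -> diagonal_basis z b K ->
  basis_of (annihilator (tangent z) (HT z)) [tuple covec z (b i) | i < 3].
Proof.
move=> z1 [bz b_free b_span _].
apply/andP; split; last first.
  apply/freeP => c c0; apply: b_free.
  have cz := conormal_sum c bz.
  have : covec z (\sum_i c i *: b i) = 0.
    rewrite covec_sum -[RHS]c0; apply: eq_bigr => i _.
    by rewrite -tnth_nth tnth_mktuple.
  (* P is itself tangent, so the zero covector may be evaluated on it. *)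
  set P := \sum_i _ => P0; have PP : dot8 P P = 0.
    have PT : P \in tangent z by rewrite mem_tangent dot8C cz.1.
    by rewrite -(covecE P PT) P0 lfunE.
  exact: dot8_eq0.
rewrite eqEsubv; apply/andP; split.
  apply/span_subvP => l /mapP[i _ ->].
  by apply/(covec_annihilator z1) => //; apply: (bz i).1.
apply/subvP => l /(annihilatorP z1)[P /b_span[c ->] ->].
rewrite covec_sum; apply: memv_suml => i _; apply: memvZ; apply: memv_span.
by apply/mapP; exists i; rewrite ?mem_enum.
Qed.

End Conormal.

(** * Brackets of sections *)

Section Sections.
Variable R : realType.
Implicit Types (u v w z P p : R8 R).

Lemma coord1_continuous i : continuous (fun z : R8 R => z.1 0 i : R^o).
Proof.
move=> z; apply: (@cvg_comp _ _ _ fst (fun x : 'rV[R]_4 => x 0 i) _ (nbhs z.1));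
  [exact: cvg_fst|exact: coord_continuous].
Qed.

Lemma coord2_continuous i : continuous (fun z : R8 R => z.2 0 i : R^o).
Proof.
move=> z; apply: (@cvg_comp _ _ _ snd (fun x : 'rV[R]_4 => x 0 i) _ (nbhs z.2));
  [exact: cvg_snd|exact: coord_continuous].
Qed.

Lemma dot8_continuous P : continuous (dot8 P : R8 R -> R^o).
Proof.
move=> z; apply: cvgD; (apply: cvg_big => [|i _]; first exact: add_continuous);
  apply: cvgM; try exact: cvg_cst.
  exact: coord1_continuous.
exact: coord2_continuous.
Qed.

Lemma dot8_differentiable P z : differentiable (dot8 P : R8 R -> R^o) z.
Proof. exact/linear_differentiable/dot8_continuous. Qed.

Lemma diff_dot8 P z v : 'd (dot8 P : R8 R -> R^o) z v = dot8 P v.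
Proof. by rewrite diff_lin //; exact: dot8_continuous. Qed.

Lemma diff_scale (f : R -> R) (t : R) u : derivable f t 1 ->
  differentiable (( *:%R^~ u : R -> R8 R) \o f) t /\
  'd (( *:%R^~ u : R -> R8 R) \o f) t 1 = 'D_1 f t *: u.
Proof.
move=> /derivable1_diffP df.
have [dg dgE] : is_diff (f t) ( *:%R^~ u : R -> R8 R) ( *:%R^~ u : R -> R8 R).
  exact: is_diff_scalel.
split; first exact: differentiable_comp.
rewrite (diff_comp df dg) [LHS]/= dgE.
by rewrite (deriveE (1 : R) df).
Qed.

(** After rescaling v to a unit vector w, h is constant along the great circle cos(t) z + sin(t) w,
    whose velocity at 0 is w. *)
Lemma diff_sphere (h : R8 R -> R^o) z v : S7 z -> dot8 z v = 0 ->
  differentiable h z -> (forall p, S7 p -> h p = 0) -> 'd h z v = 0.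
Proof.
move=> z1 zv dh h0.
have [->|v0] := eqVneq v 0; first by rewrite linear0.
have vv : 0 < dot8 v v.
  rewrite lt_neqAle addr_ge0 ?dot4_ge0 // andbT eq_sym.
  by apply: contra v0 => /eqP/dot8_eq0/eqP.
pose r := Num.sqrt (dot8 v v); have r0 : r != 0 by rewrite sqrtr_eq0 -ltNge.
have [w [vE zw ww]] : exists w, [/\ v = r *: w, dot8 z w = 0 & dot8 w w = 1].
  exists (r^-1 *: v); rewrite scalerA mulfV // scale1r dot8Zr zv mulr0; split=> //.
  by rewrite dot8Zr dot8Zl -[dot8 v v]sqr_sqrtr ?ltW // -/r; field.
suff hw : 'd h z w = 0 by rewrite vE linearZ /= hw scaler0.
pose c := (( *:%R^~ z : R -> R8 R) \o cos) + (( *:%R^~ w : R -> R8 R) \o sin).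
have c0 : c 0 = z by rewrite /c fctE /= cos0 sin0 scale1r scale0r addr0.
have c1 t : S7 (c t).
  rewrite /S7 /= /c fctE /= dot8Dr !dot8Dl !dot8Zr !dot8Zl.
  rewrite zw (dot8C w z) zw ww z1.
  rewrite -[RHS](cos2Dsin2 t); ring.
have dcos : derivable (cos : R -> R) 0 1 by exact: ex_derive.
have dsin : derivable (sin : R -> R) 0 1 by exact: ex_derive.
have [dl1 dl1E] := diff_scale z dcos.
have [dl2 dl2E] := diff_scale w dsin.
have dc : differentiable c (0 : R) by exact: differentiableD.
have dcw : 'd c (0 : R) 1 = w.
  transitivity ('d (( *:%R^~ z : R -> R8 R) \o cos) (0 : R) 1 +
                'd (( *:%R^~ w : R -> R8 R) \o sin) (0 : R) 1).
    by have /(congr1 (fun g : R -> R8 R => g 1)) := diffD dl1 dl2.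
  apply: (etrans (congr2 +%R dl1E dl2E)).
  rewrite !derive_val cos0 sin0 oppr0.
  by rewrite scale0r scale1r add0r.
have : 'd (h \o c) (0 : R) 1 = 0.
  have -> : h \o c = cst 0 by apply/funext => t /=; rewrite h0.
  by rewrite diff_cst.
by rewrite diff_comp ?c0 //= dcw.
Qed.

Lemma differentiable_dot8 (f g : R8 R -> R8 R) z :
  (forall P, differentiable ((dot8 P : R8 R -> R^o) \o f) z) ->
  (forall P, differentiable ((dot8 P : R8 R -> R^o) \o g) z) ->
  differentiable (fun p => dot8 (f p) (g p) : R^o) z.
Proof.
move=> df dg.
pose E1 i : R8 R := (delta_mx 0 i, 0); pose E2 i : R8 R := (0, delta_mx 0 i).
have dot4_delta (i : 'I_4) (x : R4 R) : dot4 (delta_mx 0 i) x = x 0 i.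
  rewrite /dot4 (bigD1 i) //= mxE !eqxx mul1r big1 ?addr0 // => j ij.
  by rewrite mxE (negbTE ij) andbF mul0r.
have dot04 (x : R4 R) : dot4 0 x = 0.
  by rewrite /dot4 big1 // => i _; rewrite mxE mul0r.
have -> : (fun p => dot8 (f p) (g p) : R^o) =
    \sum_i (dot8 (E1 i) \o f) * (dot8 (E1 i) \o g) +
    \sum_i (dot8 (E2 i) \o f) * (dot8 (E2 i) \o g).
  apply/funext => p; rewrite /= fctE !fct_sumE.
  by congr (_ + _); apply: eq_bigr => i _;
    rewrite /= fctE /= /E1 /E2 /dot8 /= !dot4_delta !dot04 ?addr0 ?add0r.
by apply: differentiableD; apply: differentiable_sum => i; apply: differentiableM.
Qed.

(* On the sphere, P . Y = sum_b (frame b . Y) (P . frame b), and the factor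
   P . frame b vanishes at z: only its derivative contributes. *)
Lemma derive_section (Y : R8 R -> R8 R) z v P :
  S7 z -> dot8 z v = 0 -> (forall a, dot8 P (frame a z) = 0) ->
  is_section (@HT R) Y ->
  dot8 P ('D_v Y z) = \sum_b dot8 (frame b z) (Y z) * dot8 P (frame b v).
Proof.
move=> z1 zv Pf sY; have [dY _] := sY z z1.
pose A : R8 R -> R^o := dot8 P \o Y.
pose B b : R8 R -> R^o := fun p => dot8 (frame b p) (Y p).
(* By skewness this is p |-> P . A_b p, written as a functional whose derivative is known. *)
pose C b : R8 R -> R^o := dot8 (- frame b P).
have CE b p : C b p = dot8 P (frame b p).
  by rewrite /C frame_skew dot8Nl.
have dA : is_derive z v A (dot8 P ('D_v Y z)).
  apply: DeriveDef.
    by apply: diff_derivable; apply: differentiable_comp => //; exact: dot8_differentiable.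
  rewrite deriveE; last by apply: differentiable_comp => //; exact: dot8_differentiable.
  rewrite diff_comp //; last exact: dot8_differentiable.
  by rewrite [LHS]/= diff_dot8 deriveE.
have dB' b : differentiable (B b) z.
  apply: differentiable_dot8 => Q.
    have -> : (dot8 Q : R8 R -> R^o) \o frame b = dot8 (- frame b Q).
      by apply/funext => p; rewrite /= frame_skew dot8Nl.
    exact: dot8_differentiable.
  by apply: differentiable_comp => //; exact: dot8_differentiable.
have dB b : is_derive z v (B b) ('D_v (B b) z).
  by apply: derivableP; apply: diff_derivable; exact: dB'.
have dC b : is_derive z v (C b) (C b v).
  apply: DeriveDef; first by apply: diff_derivable; exact: dot8_differentiable.
  by rewrite deriveE ?diff_dot8 //; exact: dot8_differentiable.
have dh := is_deriveB dA (is_derive_sum (fun b => is_deriveM (dB b) (dC b))).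
set h := A - _ in dh.
have hE p : h p = dot8 P (Y p) - \sum_b dot8 (frame b p) (Y p) * dot8 P (frame b p).
  by rewrite /h fctE /= fct_sumE; congr (_ - _); apply: eq_bigr => b _;
    rewrite fctE /= CE.
have diff_h : differentiable h z.
  apply: differentiableB.
    by apply: differentiable_comp => //; exact: dot8_differentiable.
  apply: differentiable_sum => b; apply: differentiableM; last exact: dot8_differentiable.
  exact: dB'.
have h0 : forall p, S7 p -> h p = 0.
  move=> p p1; rewrite hE {1}(HT_coord p1 (sY p p1).2) dot8_sumr.
  by apply/eqP; rewrite subr_eq0; apply/eqP/eq_bigr => b _; rewrite dot8Zr.
have := diff_sphere z1 zv diff_h h0; rewrite -deriveE // derive_val.
move/eqP; rewrite subr_eq0 => /eqP ->; apply: eq_bigr => b _.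
by rewrite !CE Pf scale0r addr0.
Qed.

End Sections.

(** * Type of the distribution *)

Section DualCurvature.
Variable R : realType.
Implicit Types (z P : R8 R).

(** Used twice: conormal P give the curvature, and P = z shows that the bracket is tangent to the
    sphere. *)
Lemma dot8_bracket (X Y : R8 R -> R8 R) z P :
  S7 z -> (forall a, dot8 P (frame a z) = 0) ->
  is_section (@HT R) X -> is_section (@HT R) Y ->
  dot8 P (bracket X Y z) = dot8 P (twist z (X z) (Y z)).
Proof.
move=> z1 Pf sX sY.
have tang (Z : R8 R -> R8 R) : is_section (@HT R) Z -> dot8 z (Z z) = 0.
  by move=> sZ; apply/eqP; rewrite -mem_tangent (subvP (HT_tangent z)) // (sZ z z1).2.
rewrite dot8Br (derive_section z1 (tang X sX) Pf sY).
rewrite (derive_section z1 (tang Y sY) Pf sX) dot8_sumr -sumrB.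
by apply: eq_bigr => b _; rewrite dot8Br !dot8Zr.
Qed.

Lemma bracket_tangent (X Y : R8 R -> R8 R) z : S7 z ->
  is_section (@HT R) X -> is_section (@HT R) Y -> bracket X Y z \in tangent z.
Proof.
move=> z1 sX sY; rewrite mem_tangent dot8_bracket //.
  by rewrite -mem_tangent twist_tangent.
by move=> a; apply/eqP; rewrite -mem_tangent frame_tangent.
Qed.

Definition dual_curvature z (l : covector (tangent z))
    (w : 'I_2 -> subvs_of (HT z)) : R :=
  - l (vsproj (tangent z) (twist z (vsval (w ord0)) (vsval (w ord_max)))).

Lemma alternating2_exterior_form (U : lmodType R) (F : U -> U -> R) :
  (forall (u : U) k (v w : U), F u (k *: v + w) = k * F u v + F u w) ->
  (forall u v : U, F v u = - F u v) ->
  exterior_form (fun w : 'I_2 -> U => F (w ord0) (w ord_max)).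
Proof.
move=> linF antiF.
have lin_l k (u v w : U) : F (k *: v + w) u = k * F v u + F w u.
  by rewrite antiF linF opprD -mulrN -!antiF.
have ord2 (i : 'I_2) : i = ord0 \/ i = ord_max.
  by case: i => [[|[|//]] ?]; [left|right]; apply: val_inj.
have F0 (u : U) : F u u = 0.
  by have /eqP := antiF u u; rewrite -addr_eq0 -mulr2n mulrn_eq0 => /eqP.
split=> [i v k x y|v i j]; first by case: (ord2 i) => -> /=; rewrite ?lin_l ?linF.
by case: (ord2 i) (ord2 j) => -> [] -> //= _ ->; rewrite F0.
Qed.

Lemma dual_curvature_covec z P : dual_curvature (covec z P) =
  fun w => - dot8 P (twist z (vsval (w ord0)) (vsval (w ord_max))).
Proof. by apply/funext => w; rewrite /dual_curvature covecE // twist_tangent. Qed.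

Lemma dual_curvatureP z l : S7 z -> l \in annihilator (tangent z) (HT z) ->
  is_dual_curvature l (dual_curvature l).
Proof.
move=> z1 /(annihilatorP z1)[P [Pz Pf] ->]; split.
  rewrite dual_curvature_covec.
  apply: (alternating2_exterior_form
    (F := fun u v : subvs_of (HT z) => - dot8 P (twist z (vsval u) (vsval v))))
    => [u k v w|u v].
    by rewrite linearP twist_linear dot8Dr dot8Zr opprD mulrN.
  by rewrite twistC dot8Nr.
move=> X Y sX sY; rewrite dual_curvature_covec /two_vectors /=.
rewrite !vsprojK ?(sX z z1).2 ?(sY z z1).2 //.
by rewrite covecE ?bracket_tangent // dot8_bracket.
Qed.

(** The quadratic form has to be a function of the covector, not of P. The vectors (xe, 0) and (0,
    ye) are tangent because e is imaginary. *)
Definition covec_pfaffian z (l : covector (tangent z)) : R :=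
  \sum_i (l (vsproj (tangent z) (qmul z.1 (im R i), 0)) ^+ 2 -
          l (vsproj (tangent z) (0, qmul z.2 (im R i))) ^+ 2).

Lemma covec_pfaffianE z P : covec_pfaffian (covec z P) = pfaffian z P.
Proof.
have dot0 (x : R4 R) : dot4 x 0 = 0.
  by rewrite /dot4 big1 // => i _; rewrite mxE mulr0.
have dot_im (x : R4 R) i : dot4 x (qmul x (im R i)) = 0.
  by move: i; apply: ord3P; rewrite imE [x]quat_eta qmul_units dot4_quat; ring.
apply: eq_bigr => i _; rewrite !covecE ?mem_tangent /dot8 /= ?dot0 ?addr0 ?add0r //.
  by rewrite dot_im.
by rewrite dot_im.
Qed.

Definition frame_det z (v : 'I_(2 + 2) -> subvs_of (HT z)) : R :=
  \det (\matrix_(i, a) dot8 (frame a z) (vsval (v i))).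

Lemma wedge_dual_curvature z l (v : 'I_(2 + 2) -> subvs_of (HT z)) :
  S7 z -> l \in annihilator (tangent z) (HT z) ->
  wedge (dual_curvature l) (dual_curvature l) v =
  covec_pfaffian l * (8 * frame_det v).
Proof.
move=> z1 /(annihilatorP z1)[P _ ->].
by rewrite dual_curvature_covec wedge_twist // covec_pfaffianE mulrCA mulrA.
Qed.

Lemma exterior_formZ (U : lmodType R) n (k : R) (f : ('I_n -> U) -> R) :
  exterior_form f -> exterior_form (fun v : 'I_n -> U => k * f v).
Proof.
move=> [linf altf]; split=> [i v a x y|v i j ij eq_v].
  by rewrite linf mulrDr mulrCA.
by rewrite (altf v i j) ?mulr0.
Qed.

Lemma volume_form z (k : R) : S7 z -> k != 0 ->
  exterior_form (fun v => k * @frame_det z v) /\ exists v, k * @frame_det z v != 0.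
Proof.
move=> z1 k0; split.
  apply: exterior_formZ.
  apply: (@det_exterior_form _ _ 4
    (fun a (u : subvs_of (HT z)) => dot8 (frame a z) (vsval u))).
  by move=> a c u w; rewrite [vsval _]linearP dot8Dr dot8Zr.
exists (fun i => vsproj (HT z) (frame i z)).
rewrite mulf_neq0 // /frame_det (_ : \matrix_(_, _) _ = 1%:M) ?det1 ?oner_eq0 //.
apply/matrixP => i a; rewrite !mxE vsprojK ?frame_in_HT // frame_dot z1 mulr1.
by rewrite eq_sym.
Qed.

Lemma has_signature_basis (L : vectType R) (W : {vspace L}) (Q : L -> R) n
    (b : n.-tuple L) r s :
  basis_of W b -> (r + s <= n)%N ->
  (forall c : 'I_n -> R, Q (\sum_i c i *: b`_i) =
     \sum_(i < n | (i < r)%N) c i ^+ 2 -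
     \sum_(i < n | (r <= i < r + s)%N) c i ^+ 2) ->
  has_signature W Q r s.
Proof.
move=> bW; have := size_basis bW => e; subst n => rs Qb.
by split=> //; exists b.
Qed.

Lemma of_type_diagonal z b K : S7 z -> diagonal_basis z b K ->
  if K == 0 then of_type (@HT R) 0 0 z else of_type (@HT R) 3 0 z.
Proof.
move=> z1 bK; have [K0|K0] := eqVneq K 0.
  exists (@dual_curvature z), (fun v => 1 * @frame_det z v), (fun=> 0); split.
  - by move=> l; exact: dual_curvatureP.
  - by apply: volume_form => //; exact: oner_neq0.
  - move=> l lW v; rewrite wedge_dual_curvature // mul0r.
    have [P Pz ->] := annihilatorP z1 lW.
    have [_ _ b_span bE] := bK; have [c ->] := b_span P Pz.
    by rewrite covec_pfaffianE bE K0 !mul0r.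
  - left; apply: (has_signature_basis (vbasisP _)) => // c.
    by rewrite !big_pred0 ?subrr // => i; rewrite ltn0 ?andbF.
(* With K moved into the volume form, Q is a sum of three squares whatever the sign of K. *)
exists (@dual_curvature z), (fun v => 8 * K * @frame_det z v),
  (fun l => K^-1 * covec_pfaffian l); split.
- by move=> l; exact: dual_curvatureP.
- by apply: volume_form => //; rewrite mulf_neq0 // pnatr_eq0.
- by move=> l lW v; rewrite wedge_dual_curvature //; field.
- left; apply: (has_signature_basis (annihilator_basis z1 bK)) => // c.
  have -> : \sum_i c i *: [tuple covec z (b i) | i < 3]`_i =
      covec z (\sum_i c i *: b i).
    rewrite covec_sum; apply: eq_bigr => i _.
    by rewrite -tnth_nth tnth_mktuple.
  have [_ _ _ bE] := bK; rewrite covec_pfaffianE bE mulKf //.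
  rewrite [X in _ - X]big_pred0 ?subr0 => [|i]; last first.
    by rewrite addn0 [(i < 3)%N]ltnNge andbN.
  by apply: eq_bigl => i; rewrite ltn_ord.
Qed.

(** * Openness and density of the set of points with unequal norms *)

Lemma enorm_eq (x y : R4 R) : (enorm x = enorm y) <-> (dot4 x x = dot4 y y).
Proof.
split=> [/(congr1 (fun t => t ^+ 2))|e]; last by rewrite /enorm e.
by rewrite !sqr_sqrtr ?dot4_ge0.
Qed.

Lemma open_dot4_neq : open [set z : R8 R | dot4 z.1 z.1 != dot4 z.2 z.2].
Proof.
have -> : [set z : R8 R | dot4 z.1 z.1 != dot4 z.2 z.2] =
    (fun z : R8 R => (dot4 z.1 z.1 - dot4 z.2 z.2 : R^o)) @^-1` [set t | t != 0].
  by apply/seteqP; split=> z /=; rewrite subr_eq0.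
apply: open_comp => [z _|]; last exact: open_neq.
by apply: cvgB; (apply: cvg_big => [|i _]; first exact: add_continuous);
  apply: cvgM; (exact: coord1_continuous || exact: coord2_continuous).
Qed.

(* A point with |x| = |y| is the limit of (sqrt (1 + t) x, sqrt (1 - t) y). *)
Lemma dense_dot4_neq :
  @S7 R `<=` closure [set z | S7 z /\ dot4 z.1 z.1 != dot4 z.2 z.2].
Proof.
move=> z z1; have [e|ne] := eqVneq (dot4 z.1 z.1) (dot4 z.2 z.2); last first.
  by apply: subset_closure; split.
pose c (t : R) : R8 R :=
  (Num.sqrt (1 + 1 * t) *: z.1, Num.sqrt (1 + -1 * t) *: z.2).
have c0 : c 0 = z by rewrite /c !mulr0 addr0 sqrtr1 !scale1r; case: (z).
have sqrt_cvg (k : R) :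
    Num.sqrt (1 + k * t) @[t --> (0 : R)] --> Num.sqrt (1 + k * 0).
  apply: (@continuous_comp _ _ _ (fun t : R => 1 + k * t) Num.sqrt (0 : R)).
    by apply: cvgD; [exact: cvg_cst|apply: cvgM; [exact: cvg_cst|exact: cvg_id]].
  exact: sqrt_continuous.
have c_cvg : c t @[t --> (0 : R)] --> z.
  have cvg1 := @cvgZr_tmp _ _ _ _ (nbhs_filter _) _ _ z.1 (sqrt_cvg 1).
  have cvg2 := @cvgZr_tmp _ _ _ _ (nbhs_filter _) _ _ z.2 (sqrt_cvg (-1)).
  by rewrite -c0; exact: (cvg_pair cvg1 cvg2).
move=> V /c_cvg /nbhs_ballP[r /= r0 rV].
(* The bound r / 2 puts [c t] into V, and 1 / 2 keeps 1 - t nonnegative. The squared norms of the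
   components of [c t] differ by t > 0. *)
pose t := Num.min (r / 2) (1 / 2).
have t0 : 0 < t by rewrite lt_min !divr_gt0.
have t1 : t <= 1 / 2 by rewrite ge_min lexx orbT.
have tr : t < r.
  by rewrite gt_min ltr_pdivrMr // mulr_natr mulr2n ltrDl r0.
exists (c t); split; last by apply: rV; rewrite /ball /= sub0r normrN gtr0_norm.
have dotZ k (x : R4 R) : dot4 (k *: x) (k *: x) = k ^+ 2 * dot4 x x.
  by rewrite /dot4 mulr_sumr; apply: eq_bigr => i _; rewrite !mxE; ring.
have h1 : 0 <= 1 + 1 * t by lra.
have h2 : 0 <= 1 + -1 * t by lra.
move: z1; rewrite /S7 /= /dot8 -e => z1.
rewrite /c /= !dotZ !sqr_sqrtr // -e; split; first by rewrite -[RHS]z1; ring.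
apply/eqP; have : dot4 z.1 z.1 = 1 / 2 by lra.
by move=> ->; lra.
Qed.

End DualCurvature.

Theorem corollary7p2 (R : realType) :
  let E : set ('rV[R]_4 * 'rV[R]_4) :=
    [set z | S7 z /\ enorm z.1 <> enorm z.2] in
  [/\ exists U : set ('rV[R]_4 * 'rV[R]_4),
        open U /\ E = @S7 R `&` U,
      @S7 R `<=` closure E,
      forall z, E z -> elliptic (@HT R) z &
      forall z, S7 z -> enorm z.1 = enorm z.2 -> of_type (@HT R) 0 0 z].
Proof.
move=> E.
have EE : E = [set z | S7 z /\ dot4 z.1 z.1 != dot4 z.2 z.2].
  apply/seteqP; split=> z [z1 ne]; split=> //.
    by apply/eqP => /enorm_eq.
  by move=> /enorm_eq/eqP; apply/negP.
split.
- by exists [set z | dot4 z.1 z.1 != dot4 z.2 z.2]; split; [exact: open_dot4_neq|].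
- by rewrite EE; exact: dense_dot4_neq.
- move=> z; rewrite EE => -[z1 ne].
  have [b [K [bK K0]]] := diagonal_basis_exists z1.
  by have := of_type_diagonal z1 bK; rewrite K0 (negbTE ne).
- move=> z z1 /enorm_eq/eqP e.
  have [b [K [bK K0]]] := diagonal_basis_exists z1.
  by have := of_type_diagonal z1 bK; rewrite K0 e.
Qed.
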